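(* The Fibonacci cut-and-project process in $\mathbb{R}$ is number rigid.
   Context: Let $\tau=(1+\sqrt5)/2$ and let $x\mapsto x^\star$ be the nontrivial Galois conjugation of $\mathbb{Q}(\sqrt5)$. Let $\Gamma=\{(x,x^\star):x\in\mathbb{Z}[\tau]\}$, a lattice in $\mathbb{R}\times\mathbb{R}$, and $W=[-1,\tau-1)$. The Fibonacci cut-and-project process is the cut-and-project process with parameters $(\mathbb{R},\mathbb{R},\Gamma,W)$: with $\Omega=(\mathbb{R}\times\mathbb{R})/\Gamma$ equipped with its Haar probability measure $\mathbb{P}$, it is the random set $\Lambda_{[g,h]}=\{x+g:x\in\mathbb{Z}[\tau],\ x^\star\in W-h\}\subset\mathbb{R}$, $[g,h]\in\Omega$. A point process $\Lambda$ in $\mathbb{R}$ defined on $(\Omega,\mathbb{P})$ is number rigid if for every bounded Borel set $B\subset\mathbb{R}$ there is a conull set $\Omega_B\subset\Omega$ such that for $\omega\in\Omega_B$ the number $\#(\Lambda_\omega\cap B)$ depends only on $\Lambda_\omega\cap B^c$ (i.e. if $\omega,\omega'\in\Omega_B$ and $\Lambda_\omega\cap B^c=\Lambda_{\omega'}\cap B^c$, then $\#(\Lambda_\omega\cap B)=\#(\Lambda_{\omega'}\cap B)$). *)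

(* Defs.v *)
From HB Require Import structures.
From mathcomp Require Import all_boot all_order all_algebra.
From mathcomp Require Import generic_quotient ring_quotient.
From mathcomp Require Import all_classical all_reals all_analysis.
From mathcomp Require Import ring lra zify.

Set Implicit Arguments.
Unset Strict Implicit.
Unset Printing Implicit Defensive.
Import Order.TTheory GRing.Theory Num.Theory.
Import numFieldNormedType.Exports.

Local Open Scope classical_set_scope.
Local Open Scope ring_scope.
Local Open Scope quotient_scope.

Definition number_rigid (d : measure_display) (T : measurableType d)
    (R : realType) (P : probability T R) (L : T -> set R) : Prop :=
  forall B : set R, measurable B -> bounded_set B ->
  exists T_B : set T, [/\ measurable T_B, P T_B = 1%E &
    forall w w' : T, T_B w -> T_B w' ->
      L w `&` ~` B = L w' `&` ~` B ->
      counting (L w `&` B) = counting (L w' `&` B) :> \bar R].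

Section golden.
Context {R : realType}.
Implicit Types x y : R.

Definition tau : R := (1 + Num.sqrt 5) / 2.

Definition Qsqrt5 : set R :=
  [set x | exists a b : rat, x = ratr a + ratr b * Num.sqrt 5].

(* The nontrivial automorphism a + b sqrt 5 |-> a - b sqrt 5 of Q(sqrt 5),
   extended by 0 outside Q(sqrt 5); (a, b) is determined by x, see conj5E. *)
Definition conj5 (x : R) : R :=
  let p := xget (0, 0)
    [set p : rat * rat | x = ratr p.1 + ratr p.2 * Num.sqrt 5] in
  ratr p.1 - ratr p.2 * Num.sqrt 5.

Definition Ztau : set R :=
  [set x | exists m n : int, x = m%:~R + n%:~R * tau].

Lemma sqrt5_sqr : Num.sqrt 5 ^+ 2 = 5 :> R.
Proof. by rewrite sqr_sqrtr. Qed.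

Lemma rat_sqr_neq5 (q : rat) : q ^+ 2 != 5.
Proof.
apply/eqP => q5.
have E : numq q * numq q = 5 * (denq q * denq q).
  apply: (@intr_inj rat); rewrite !rmorphM /= numqE -[5%:~R]q5; ring.
have {}E : (`|numq q| * `|numq q| = 5 * (`|denq q| * `|denq q|))%N.
  by move/(congr1 absz): E; rewrite !abszM.
have d0 : (0 < `|denq q|)%N by rewrite absz_gt0 denq_neq0.
have n0 : (0 < `|numq q|)%N by case: (`|numq q|)%N E; nia.
have := congr1 (fun n => odd (logn 5 n)) E.
by rewrite !lognM ?muln_gt0 ?d0 ?n0// !oddD !addbb.
Qed.

Lemma Qsqrt5_inj (a b a' b' : rat) :
  ratr a + ratr b * Num.sqrt 5 = ratr a' + ratr b' * Num.sqrt 5 :> R ->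
  a = a' /\ b = b'.
Proof.
move=> E; have [bb'|bb'] := eqVneq b b'.
  split=> //; move: E; rewrite bb' => /addIr /eqP.
  by rewrite (inj_eq (fmorph_inj (@ratr R))) => /eqP.
exfalso; have : ratr ((a' - a) / (b - b')) = Num.sqrt 5 :> R.
  rewrite fmorph_div !rmorphB /=.
  have h : ratr b - ratr b' != 0 :> R.
    by rewrite subr_eq0 (inj_eq (fmorph_inj (@ratr R))).
  by apply: (mulIf h); rewrite divfK//; lra.
move=> /(congr1 (fun x => x ^+ 2)); rewrite sqrt5_sqr -rmorphXn /=.
rewrite -(ratr_nat R 5) => /(fmorph_inj (@ratr R))/eqP.
by apply/negP; exact: rat_sqr_neq5.
Qed.

Lemma conj5E (a b : rat) :
  conj5 (ratr a + ratr b * Num.sqrt 5) = ratr a - ratr b * Num.sqrt 5.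
Proof.
rewrite /conj5; case: xgetP => [p _ /= /Qsqrt5_inj[<- <-] //|].
by move=> /(_ (a, b)) /=.
Qed.

Lemma conj5D x y : Qsqrt5 x -> Qsqrt5 y -> conj5 (x + y) = conj5 x + conj5 y.
Proof.
move=> [a [b ->]] [a' [b' ->]].
have -> : ratr a + ratr b * Num.sqrt 5 + (ratr a' + ratr b' * Num.sqrt 5) =
    ratr (a + a') + ratr (b + b') * Num.sqrt 5 :> R.
  by rewrite !rmorphD /=; ring.
by rewrite !conj5E !rmorphD /=; ring.
Qed.

Lemma conj5M x y : Qsqrt5 x -> Qsqrt5 y -> conj5 (x * y) = conj5 x * conj5 y.
Proof.
move=> [a [b ->]] [a' [b' ->]].
have S := sqrt5_sqr.
have -> : (ratr a + ratr b * Num.sqrt 5) * (ratr a' + ratr b' * Num.sqrt 5) =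
    ratr (a * a' + 5 * (b * b')) + ratr (a * b' + b * a') * Num.sqrt 5 :> R.
  by rewrite !rmorphD !rmorphM /= ratr_nat; ring: S.
by rewrite !conj5E !rmorphD !rmorphM /= ratr_nat; ring: S.
Qed.

Lemma conj5_sqrt5 : conj5 (Num.sqrt 5) = - Num.sqrt 5.
Proof.
have := conj5E 0 1.
by rewrite rmorph0 rmorph1 add0r mul1r sub0r.
Qed.

Lemma Ztau_Qsqrt5 x : Ztau x -> Qsqrt5 x.
Proof.
move=> [m [n ->]]; exists (m%:~R + n%:~R / 2), (n%:~R / 2).
rewrite rmorphD /= !fmorph_div /= !ratr_int ratr_nat /tau.
by field.
Qed.

Lemma Ztau0 : Ztau 0.
Proof. by exists 0, 0; rewrite mul0r addr0. Qed.

Lemma ZtauB x y : Ztau x -> Ztau y -> Ztau (x - y).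
Proof.
move=> [m [n ->]] [m' [n' ->]]; exists (m - m'), (n - n').
by rewrite !rmorphB /=; ring.
Qed.

Lemma conj5B x y : Qsqrt5 x -> Qsqrt5 y -> conj5 (x - y) = conj5 x - conj5 y.
Proof.
move=> [a [b ->]] [a' [b' ->]].
have -> : ratr a + ratr b * Num.sqrt 5 - (ratr a' + ratr b' * Num.sqrt 5) =
    ratr (a - a') + ratr (b - b') * Num.sqrt 5 :> R.
  by rewrite !rmorphB /=; ring.
by rewrite !conj5E !rmorphB /=; ring.
Qed.

Definition fib_lattice : set (R * R) := [set (x, conj5 x) | x in Ztau].

(* Boolean form of fib_lattice, as needed by the quotient construction. *)
Definition fib_lattice_pred : {pred R * R} := fun p => p \in fib_lattice.

Lemma fib_lattice_zmod_closed : zmod_closed fib_lattice_pred.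
Proof.
split=> [|u v]; rewrite !unfold_in /fib_lattice_pred !inE /=.
  exists 0; first exact: Ztau0.
  have := conj5B (Ztau_Qsqrt5 Ztau0) (Ztau_Qsqrt5 Ztau0).
  by rewrite !subrr => ->.
move=> [x Zx <-] [y Zy <-]; exists (x - y); first exact: ZtauB.
by rewrite conj5B//; exact: Ztau_Qsqrt5.
Qed.

HB.instance Definition _ :=
  GRing.isZmodClosed.Build (R * R)%type fib_lattice_pred fib_lattice_zmod_closed.

Definition fib_window : set R := `[-1, tau - 1[.

Definition fib_set (g h : R) : set R :=
  [set x + g | x in [set x | Ztau x /\ [set w - h | w in fib_window] (conj5 x)]].

End golden.

Arguments fib_lattice_pred R : clear implicits.

(* Its elements are the cosets [g, h] = \pi (g, h); it carries the quotient
   group structure and the Borel sigma-algebra of the quotient topology. *)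
Definition fib_torus (R : realType) : Type :=
  quotient_topology (Quotient.quot (fib_lattice_pred R)).

Section torus.
Context {R : realType}.

HB.instance Definition _ := Topological.on (fib_torus R).
HB.instance Definition _ := Quotient.on (fib_torus R).
HB.instance Definition _ := isPointed.Build (fib_torus R)
  (\pi_(fib_torus R) (0, 0)).
(* Built from the operations of Quotient.quot rather than copied, so that the
   group and topological structures share the same choiceType. *)
HB.instance Definition _ := GRing.isZmodule.Build (fib_torus R)
  (@Quotient.addqA _ (fib_lattice_pred R))
  (@Quotient.addqC _ (fib_lattice_pred R))
  (@Quotient.add0q _ (fib_lattice_pred R))
  (@Quotient.addNq _ (fib_lattice_pred R)).
HB.instance Definition _ := Measurable.copy (fib_torus R)
  (g_sigma_algebraType (@open (fib_torus R))).

Lemma fib_torus_eqP (u v : R * R) :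
  \pi_(fib_torus R) u = \pi_(fib_torus R) v <-> fib_lattice (u - v).
Proof.
have E : (u - v \in fib_lattice) =
    (u == v %[mod Quotient.quot (fib_lattice_pred R)]).
  exact: (Quotient.idealrBE (fib_lattice_pred R)).
split=> h; first by apply: set_mem; rewrite E; exact/eqP.
by move: h => /mem_set; rewrite E => /eqP.
Qed.

Lemma fib_torus_piD (u v : R * R) :
  \pi_(fib_torus R) (u + v) = \pi_(fib_torus R) u + \pi_(fib_torus R) v.
Proof. exact: (@Quotient.pi_add _ (fib_lattice_pred R)). Qed.

(* Translation-invariant Borel probability measure on the torus. *)
Definition is_haar_probability (P : probability (fib_torus R) R) : Prop :=
  forall (v : fib_torus R) (A : set (fib_torus R)), measurable A ->
    P [set w + v | w in A] = P A.

Definition fib_process (w : fib_torus R) : set R :=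
  fib_set (repr w).1 (repr w).2.

Lemma fib_set_lattice (g h g' h' : R) :
  fib_lattice ((g, h) - (g', h')) -> fib_set g h `<=` fib_set g' h'.
Proof.
move=> [z Zz [zg zh]] _ [x [Zx [w Ww wx]] <-].
have Zxz : Ztau (x + z).
  by rewrite -[z]opprK; apply: ZtauB => //; rewrite -sub0r; exact: ZtauB Ztau0 _.
exists (x + z); last by rewrite zg addrA subrK.
split=> //; exists w => //.
rewrite conj5D; [|exact: Ztau_Qsqrt5|exact: Ztau_Qsqrt5].
by rewrite -wx zh addrA subrK.
Qed.

Lemma fib_process_pi (g h : R) :
  fib_process (\pi_(fib_torus R) (g, h)) = fib_set g h.
Proof.
rewrite /fib_process; case: (piP (fib_torus R) (g, h)) => -[g' h'] E.
by apply/seteqP; split; apply: fib_set_lattice; apply/fib_torus_eqP.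
Qed.

End torus.

(* Main.v *)
Require Import Defs.
From mathcomp Require Import all_boot all_order all_algebra.
From mathcomp Require Import all_classical all_reals all_analysis.
From mathcomp Require Import ring lra.

(** The configuration outside a bounded set determines the whole configuration,
    for every point of the torus.  A point of [Λ] outside [B] determines [g]
    modulo [Z[τ]], so representatives with equal [g] may be chosen.  If then
    [h < h'], the windows [W - h] and [W - h'] differ by an interval, and this
    interval contains [x^⋆] for arbitrarily large [x] in [Z[τ]]: the powers of
    [τ ^ 2] tend to infinity while their conjugates, the powers of [τ ^ -2],
    tend to zero. *)

Set Implicit Arguments.
Unset Strict Implicit.
Unset Printing Implicit Defensive.
Import Order.TTheory GRing.Theory Num.Theory.
Import numFieldNormedType.Exports.

Local Open Scope classical_set_scope.
Local Open Scope ring_scope.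

Section fibonacci.
Context {R : realType}.
Implicit Types (x y g h : R) (B : set R).

Local Notation tau := (@tau R).

Lemma tau_sqr : tau ^+ 2 = tau + 1.
Proof. have S := @sqrt5_sqr R; rewrite /Defs.tau; nra. Qed.

Lemma tau_gt1 : 1 < tau.
Proof.
have S := @sqrt5_sqr R; have := sqrtr_ge0 (5 : R).
rewrite /Defs.tau => S0; nra.
Qed.

Lemma conj5_tau (m n : int) :
  conj5 (m%:~R + n%:~R * tau) = m%:~R + n%:~R * (1 - tau).
Proof.
have -> : m%:~R + n%:~R * tau =
    ratr (m%:~R + n%:~R / 2) + ratr (n%:~R / 2) * Num.sqrt 5 :> R.
  by rewrite rmorphD /= !fmorph_div /= !ratr_int ratr_nat /Defs.tau; field.
rewrite conj5E rmorphD /= !fmorph_div /= !ratr_int ratr_nat /Defs.tau.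
by field.
Qed.

Lemma ZtauD x y : Ztau x -> Ztau y -> Ztau (x + y).
Proof.
move=> Zx Zy; rewrite -[y]opprK; apply: ZtauB => //.
by rewrite -sub0r; apply: ZtauB => //; exact: Ztau0.
Qed.

Lemma ZtauM x y : Ztau x -> Ztau y -> Ztau (x * y).
Proof.
move=> [m [n ->]] [m' [n' ->]].
exists (m * m' + n * n'), (m * n' + n * m' + n * n').
have S := tau_sqr; rewrite !rmorphD !rmorphM /=; ring: S.
Qed.

Lemma conj5_expr x (n : nat) : Ztau x ->
  Ztau (x ^+ n) /\ conj5 (x ^+ n) = conj5 x ^+ n.
Proof.
move=> Zx; elim: n => [|n [Zn IH]].
  rewrite !expr0; have E : 1 = 1%:~R + 0%:~R * tau :> R by rewrite mul0r addr0.
  split; first by exists 1, 0.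
  by rewrite [in LHS]E conj5_tau mul0r addr0.
rewrite !exprS; split; first exact: ZtauM.
by rewrite conj5M ?IH//; exact: Ztau_Qsqrt5.
Qed.

(** Powers of [tau ^+ 2] are used rather than of [tau], whose conjugate [1 - tau] is negative and
    would give alternating signs. *)
Lemma Ztau_large_small (M e : R) : 0 < e ->
  exists y, [/\ Ztau y, M < y & 0 < conj5 y < e].
Proof.
move=> e0; have S := tau_sqr; have t1 := tau_gt1.
have Et : tau ^+ 2 = 1%:~R + 1%:~R * tau by rewrite S mul1r addrC.
have Zq : Ztau (tau ^+ 2) by rewrite Et; exists 1, 1.
have Cq : conj5 (tau ^+ 2) = (tau ^+ 2)^-1.
  have t0 : tau ^+ 2 != 0 by rewrite expf_eq0 /=; lra.
  by apply: (mulIf t0); rewrite mulVf// {1}Et conj5_tau; ring: S.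
(* Since [tau ^+ 2 = tau + 1 > 2], it suffices that [2 ^+ n] exceeds both [M] and [e^-1]. *)
pose n := Num.bound (`|M| + e^-1).
have [Zn Cn] := conj5_expr n Zq.
have big : `|M| + e^-1 < (tau ^+ 2) ^+ n.
  apply: (@lt_le_trans _ _ (2 ^+ n)).
    by apply: upper_nthrootP; rewrite leqnn.
  by apply: lerXn2r; rewrite ?nnegrE; lra.
have ei : 0 < e^-1 by rewrite invr_gt0.
have Mn := ler_norm M; have M0 := normr_ge0 M.
exists ((tau ^+ 2) ^+ n); split=> //; first by lra.
rewrite Cn Cq exprVn invr_gt0; apply/andP; split; first by lra.
rewrite -[ltRHS]invrK ltf_pV2 ?posrE//; lra.
Qed.

(** An integer multiple of an element with small conjugate brings the conjugate into the first half
    of [[a, b)]. Adding a large element with small conjugate then passes [M] without leaving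
    [[a, b)]. *)
Lemma Ztau_conj5_dense (M a b : R) : a < b ->
  exists x, [/\ Ztau x, M < x & a <= conj5 x < b].
Proof.
move=> ab; have e0 : 0 < (b - a) / 2 by lra.
have [y [Zy _ /andP[y0 ye]]] := Ztau_large_small 0 e0.
pose k := Num.ceil (a / conj5 y).
have Ek : k%:~R = k%:~R + 0%:~R * tau :> R by rewrite mul0r addr0.
have Zk : Ztau (k%:~R : R) by exists k, 0.
have Ck : conj5 (k%:~R : R) = k%:~R.
  by rewrite [in LHS]Ek conj5_tau mul0r addr0.
have Zky := ZtauM Zk Zy.
have Cky : conj5 (k%:~R * y) = k%:~R * conj5 y.
  by rewrite conj5M ?Ck//; exact: Ztau_Qsqrt5.
have lo : a <= k%:~R * conj5 y by rewrite -ler_pdivrMr// ceil_ge.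
have hi : (k%:~R - 1) * conj5 y < a.
  by rewrite -ltr_pdivlMr//; have := gt_pred_ceil (a / conj5 y);
     rewrite -/k rmorphB.
(* The bound is relative to [k%:~R * y], which may be very negative. *)
have [z [Zz zM /andP[z0 ze]]] := Ztau_large_small (M - k%:~R * y) e0.
exists (k%:~R * y + z); split; [exact: ZtauD|lra|].
by rewrite conj5D; [rewrite Cky; lra|exact: Ztau_Qsqrt5..].
Qed.

Lemma fib_setP g h x : fib_set g h (x + g) <->
  Ztau x /\ -1 - h <= conj5 x < tau - 1 - h.
Proof.
split=> [[y [Zy [w]]]|[Zx xh]].
  rewrite /fib_window /= in_itv /= => wW wy /addIr <-; split=> //.
  by rewrite -wy; lra.
exists x => //; split=> //; exists (conj5 x + h); last by rewrite addrK.
by rewrite /fib_window /= in_itv /=; lra.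
Qed.

Lemma bounded_set_ub B : bounded_set B -> exists M, forall x, B x -> x <= M.
Proof.
move=> [M [_ BM]]; exists (M + 1) => x Bx; apply: le_trans (ler_norm x) _.
by apply: BM => //; lra.
Qed.

(** Supplies the point outside [B] through which the translations [g] of two configurations are
    compared. *)
Lemma fib_set_unbounded g h B : bounded_set B ->
  exists x, fib_set g h x /\ ~ B x.
Proof.
move=> /bounded_set_ub[M BM]; have t1 := tau_gt1.
have [|x [Zx xM xh]] := @Ztau_conj5_dense (M - g) (-1 - h) (tau - 1 - h).
  by lra.
exists (x + g); split; first exact/fib_setP.
by move=> /BM; lra.
Qed.

Lemma fib_set_shift_le g h h' B : bounded_set B ->
  fib_set g h' `&` ~` B `<=` fib_set g h -> h' <= h.
Proof.
move=> /bounded_set_ub[M BM] sub; rewrite leNgt; apply/negP => hh'.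
have t1 := tau_gt1.
(* This interval lies in [W - h'] and below [W - h]; the minimum covers the case of disjoint
   windows. *)
have [|x [Zx xM /andP[x1]]] :=
    @Ztau_conj5_dense (M - g) (-1 - h') (Num.min (-1 - h) (tau - 1 - h')).
  by rewrite lt_min; lra.
rewrite lt_min => /andP[x2 x3].
have /sub /fib_setP[_] : (fib_set g h' `&` ~` B) (x + g).
  by split; [apply/fib_setP; split=> //; lra|move=> /BM; lra].
lra.
Qed.

Lemma fib_set_rigid g h g' h' B : bounded_set B ->
  fib_set g h `&` ~` B = fib_set g' h' `&` ~` B ->
  fib_set g h = fib_set g' h'.
Proof.
move=> bB E; have [p [pL pB]] := fib_set_unbounded g h bB.
have [] : (fib_set g' h' `&` ~` B) p by rewrite -E.
case: pL => x [Zx _] <- [x' [Zx' _] xx'] _.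
(* The common point is [x + g = x' + g'], so [g' - g = x - x']. *)
have Zz : Ztau (g' - g) by have := ZtauB Zx Zx'; congr Ztau; lra.
(* Subtracting the lattice vector over [g' - g] turns [(g', h')] into [(g, h'')], another
   representative of the same coset. *)
pose h'' := h' - conj5 (g' - g).
have F : fib_set g' h' = fib_set g h''.
  apply/seteqP; split; apply: fib_set_lattice.
    by exists (g' - g) => //; congr pair; rewrite /h'' /=; ring.
  have Zz' : Ztau (g - g') by rewrite -opprB -sub0r; apply: ZtauB Ztau0 _.
  have Cz : conj5 (g - g') + conj5 (g' - g) = 0.
    rewrite -conj5D; [|exact: Ztau_Qsqrt5..].
    by have := conj5_tau 0 0; rewrite !mul0r addr0 addrA subrK subrr.
  by exists (g - g') => //; congr pair; rewrite /h'' /=; lra.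
rewrite F in E *; congr fib_set; apply/le_anti/andP; split.
- by apply: (@fib_set_shift_le g _ _ B bB); rewrite E => ? [].
- by apply: (@fib_set_shift_le g _ _ B bB); rewrite -E => ? [].
Qed.

End fibonacci.

Theorem corollary1p11 (R : realType) (P : probability (fib_torus R) R) :
  is_haar_probability P -> number_rigid P (@fib_process R).
Proof.
move=> _ B _ bB; exists setT; split=> [||w w' _ _ E].
- exact: measurableT.
- exact: probability_setT.
- by congr (counting (_ `&` B)); exact: fib_set_rigid bB E.
Qed.
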